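(* Let $A_0,A_1,A_2\in\mathbb{C}^{n,n}$ and let $D=\{\lambda\in\mathbb{C}:|\lambda|<r\}$, where $r>0$ is such that $r\|A_1\|+r^2\|A_2\|<\sigma_{\min}(A_0)$. Then the bivariate polynomial $Q(z_1,z_2)=z_1^2A_2+z_2A_1+A_0$ is stable with respect to $D^2$ and, consequently, the matrix polynomial $P(\lambda)=\lambda^2A_2+\lambda A_1+A_0$ is regular and hyperstable with respect to $D$.
   Context: $\|\cdot\|$ is the operator two-norm and $\sigma_{\min}(A)=\sqrt{\min\sigma(A^*A)}$ is the smallest singular value of $A$. A bivariate matrix polynomial $Q(z_1,z_2)\in\mathbb{C}^{n,n}[z_1,z_2]$ is stable with respect to a nonempty set $\Omega\subseteq\mathbb{C}^2$ if for all $(w_1,w_2)\in\Omega$ and all $x\in\mathbb{C}^n\setminus\{0\}$ there exists $y\in\mathbb{C}^n\setminus\{0\}$ with $y^*Q(w_1,w_2)x\neq0$ (equivalently, $\det Q(w_1,w_2)\neq0$ on $\Omega$). A matrix polynomial $P(\lambda)\in\mathbb{C}^{n,n}[\lambda]$ is regular if $\det P(\lambda)\not\equiv0$. A regular $P(\lambda)$ is hyperstable with respect to a nonempty open or closed $D\subseteq\mathbb{C}$ if for every $x\in\mathbb{C}^n\setminus\{0\}$ there exists $y\in\mathbb{C}^n\setminus\{0\}$ such that $y^*P(\mu)x\neq0$ for all $\mu\in D$. *)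

(* Defs.v *)
From HB Require Import structures.
From mathcomp Require Import all_boot all_order all_algebra complex.
From mathcomp Require Import all_classical all_reals topology normedtype.
Set Implicit Arguments.
Unset Strict Implicit.
Unset Printing Implicit Defensive.
Import Order.TTheory GRing.Theory Num.Theory.
Import numFieldNormedType.Exports.
Local Open Scope classical_set_scope.
Local Open Scope ring_scope.
Local Open Scope complex_scope.
Local Open Scope sesquilinear_scope.

Lemma seq_min (R : realType) (x : R) (l : seq R) : x \in l ->
  exists2 m, m \in l & forall t, t \in l -> m <= t.
Proof.
elim: l x => // y [_ x _|z l IH x _].
  by exists y; rewrite ?mem_head// => t; rewrite inE => /eqP ->.
have [m ml mmin] := IH z (mem_head _ _).
exists (Num.min y m).
  by rewrite /Num.min; case: ifP; rewrite in_cons ?eqxx// ml orbT.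
move=> t; rewrite in_cons ge_min => /predU1P[->|/mmin ->].
  by rewrite lexx.
by rewrite orbT.
Qed.

Section Norms.
Variables (R : realType) (n : nat).
Implicit Type A : 'M[R[i]]_n.

Definition norm2 (x : 'cV[R[i]]_n) : R :=
  Num.sqrt (\sum_i (Normc.normc (x i 0)) ^+ 2).

Definition opnorm2 A : R :=
  sup [set norm2 (A *m x) | x in [set x | norm2 x = 1]].

(* For 0 < n the eigenvalues of A^* A form a nonempty finite set of
   nonnegative reals, so that the infimum is a minimum: see [sigma_minP]. *)
Definition sigma_min A : R :=
  Num.sqrt (inf [set s : R | eigenvalue (A^t* *m A) s%:C]).

Lemma gram_eigenvalue_ge0 A (a : R[i]) : eigenvalue (A^t* *m A) a -> 0 <= a.
Proof.
case/eigenvalueP => v vA v0.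
have dot m (u : 'rV[R[i]]_m) : (u *m u^t*) 0 0 = \sum_j `|u 0 j| ^+ 2.
  by rewrite mxE; apply: eq_bigr => j _; rewrite !mxE normCK.
have dot_ge0 m (u : 'rV[R[i]]_m) : 0 <= (u *m u^t*) 0 0.
  by rewrite dot sumr_ge0// => j _; rewrite exprn_ge0.
have dot_gt0 : 0 < (v *m v^t*) 0 0.
  rewrite lt_def dot_ge0 andbT; apply: contra v0; rewrite dot.
  rewrite psumr_eq0 => [/allP v0|j _]; last by rewrite exprn_ge0.
  apply/eqP/rowP => j; rewrite mxE; apply/eqP.
  by have /= := v0 j (mem_index_enum j); rewrite expf_eq0/= normr_eq0.
have := dot_ge0 _ (v *m A^t*).
rewrite trmx_mul map_mxM trmxCK -mulmxA (mulmxA _ A) mulmxA vA -scalemxAl mxE.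
by rewrite pmulr_lge0.
Qed.

Lemma sigma_minP A : (0 < n)%N ->
  exists s : R, [/\ sigma_min A = Num.sqrt s, eigenvalue (A^t* *m A) s%:C &
    forall a : R[i], eigenvalue (A^t* *m A) a -> s%:C <= a].
Proof.
move=> n_gt0; set E := [set s : R | eigenvalue (A^t* *m A) s%:C].
have realE (a : R[i]) : eigenvalue (A^t* *m A) a -> (complex.Re a)%:C = a.
  move/gram_eigenvalue_ge0; case: a => x y; rewrite lecE/= => /andP[/eqP -> _].
  by [].
pose rs := sval (closed_field_poly_normal (char_poly (A^t* *m A))).
have rsP (a : R[i]) : eigenvalue (A^t* *m A) a = (a \in rs).
  rewrite eigenvalue_root_char /rs; case: closed_field_poly_normal => /= s ->.
  by rewrite (monicP (char_poly_monic _)) scale1r root_prod_XsubC.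
have [a0 a0E] := eigenvalue_closed (A^t* *m A) n_gt0.
have [s sE smin] : exists2 s : R, E s & forall t, E t -> s <= t.
  pose l := [seq complex.Re a | a <- rs].
  have lE x : x \in l -> E x.
    by case/mapP => a ars ->; rewrite /E/= realE rsP.
  have l0 : complex.Re a0 \in l by apply: map_f; rewrite -rsP.
  have [m ml mmin] : exists2 m, m \in l & forall t, t \in l -> m <= t.
    exact: seq_min l0.
  exists m => [|t Et]; first exact: lE.
  by apply/mmin/mapP; exists t%:C => //; rewrite -rsP.
exists s; split=> //.
- rewrite /sigma_min -/E; congr Num.sqrt; apply/eqP; rewrite eq_le.
  rewrite ge_inf//=; last by exists s => t; exact: smin.
  by apply: lb_le_inf; [exists s|move=> t; exact: smin].
- move=> a aE; rewrite -(realE a aE) lecR; apply: smin.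
  by rewrite /E/= realE.
Qed.

End Norms.

Section MatrixPolynomials.
Variables (R : realType) (n : nat).
Local Notation C := R[i].

Definition mxeval (P : 'M[{poly C}]_n) (mu : C) : 'M[C]_n :=
  map_mx (fun p => p.[mu]) P.

(* [q.[x, y]] evaluates 'X at x and 'Y at y: 'X stands for z1, 'Y for z2. *)
Definition mxeval2 (Q : 'M[{poly {poly C}}]_n) (w : C * C) : 'M[C]_n :=
  map_mx (fun q => q.[w.1, w.2]) Q.

Definition stable2 (Q : 'M[{poly {poly C}}]_n) (Omega : set (C * C)) : Prop :=
  Omega !=set0 /\
  forall w, Omega w -> forall x : 'cV[C]_n, x != 0 ->
    exists2 y : 'cV[C]_n, y != 0 & y^t* *m mxeval2 Q w *m x != 0.

Definition regular_mxpoly (P : 'M[{poly C}]_n) : Prop := \det P != 0.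

(* [C^o] carries the topology of the modulus on C. *)
Definition hyperstable (P : 'M[{poly C}]_n) (D : set C) : Prop :=
  [/\ regular_mxpoly P, D !=set0, open (D : set C^o) \/ closed (D : set C^o) &
  forall x : 'cV[C]_n, x != 0 ->
    exists2 y : 'cV[C]_n, y != 0 &
      forall mu, D mu -> y^t* *m mxeval P mu *m x != 0].

End MatrixPolynomials.

(* Main.v *)
(** With [y = A0 x] one has [y^* Q(z1,z2) x = |A0 x|^2 + z1^2 y^* A2 x + z2 y^* A1 x],
    and by Cauchy-Schwarz the last two terms have modulus at most
    [|A0 x| (r^2 |A2| + r |A1|) |x| < |A0 x| sigma_min(A0) |x| <= |A0 x|^2].
    This [y] depends on [x] only, which gives hyperstability as well as stability. *)
Require Import Defs.
From mathcomp Require Import all_boot all_order all_algebra complex.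
From mathcomp Require Import all_classical all_reals topology normedtype.
Set Implicit Arguments.
Unset Strict Implicit.
Unset Printing Implicit Defensive.
Import Order.TTheory GRing.Theory Num.Theory.
Import numFieldNormedType.Exports.
Local Open Scope classical_set_scope.
Local Open Scope ring_scope.
Local Open Scope complex_scope.

Section EuclideanNorm.
Local Open Scope sesquilinear_scope.
Variable R : realType.
Local Notation C := R[i].

Lemma norm_normcE (z : C) : `|z| = (Normc.normc z)%:C.
Proof. by []. Qed.

Lemma normc_ge0 (z : C) : 0 <= Normc.normc z.
Proof. by rewrite -lecR -norm_normcE normr_ge0. Qed.

Lemma norm2_ge0 n (x : 'cV[C]_n) : 0 <= norm2 x.
Proof. exact: sqrtr_ge0. Qed.

Lemma norm2_sqr n (x : 'cV[C]_n) : (norm2 x ^+ 2)%:C = (x^t* *m x) 0 0.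
Proof.
rewrite sqr_sqrtr; last by rewrite sumr_ge0// => i _; rewrite sqr_ge0.
rewrite mxE rmorph_sum; apply: eq_bigr => i _.
by rewrite !mxE rmorphXn /= -norm_normcE normCK mulrC.
Qed.

(** [dotmx] pairs row vectors, so columns enter through their adjoints; this gives access to
    definiteness and [CauchySchwarz]. *)
Lemma dotmx_trmxC n (x y : 'cV[C]_n) :
  dotmx (x^t*) (y^t*) = (x^t* *m y) 0 0.
Proof. by rewrite dotmxE trmxCK. Qed.

Lemma norm2_gt0 n (x : 'cV[C]_n) : x != 0 -> 0 < norm2 x.
Proof.
move=> x0; rewrite lt_def norm2_ge0 andbT -sqrf_eq0.
rewrite -(inj_eq (@complexI R)) norm2_sqr -dotmx_trmxC dnorm_eq0.
by apply: contra x0 => /eqP x0; rewrite -(trmxCK x) x0 trmx0 map_mx0.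
Qed.

Lemma norm2Z n (a : C) (x : 'cV[C]_n) :
  norm2 (a *: x) = Normc.normc a * norm2 x.
Proof.
rewrite /norm2 -[in RHS](ger0_norm (normc_ge0 a)) -sqrtr_sqr -sqrtrM ?sqr_ge0//.
congr Num.sqrt; rewrite mulr_sumr; apply: eq_bigr => i _.
by rewrite mxE Normc.normcM exprMn.
Qed.

Lemma norm2_CauchySchwarz n (x y : 'cV[C]_n) :
  `|(x^t* *m y) 0 0| <= (norm2 x * norm2 y)%:C.
Proof.
rewrite -dotmx_trmxC -(@ler_pXn2r _ 2)// ?nnegrE ?normr_ge0//; last first.
  by rewrite lecR mulr_ge0 ?norm2_ge0.
rewrite -[leRHS]rmorphXn exprMn rmorphM /= !norm2_sqr -!dotmx_trmxC.
exact: (CauchySchwarz _ _ _).1.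
Qed.

(** Cauchy-Schwarz on each row of [A] bounds the set by the Frobenius norm. [sup] is an upper bound
    only once boundedness is known. *)
Lemma has_ubound_opnorm2 n (A : 'M[C]_n) :
  has_ubound [set norm2 (A *m x) | x in [set x | norm2 x = 1]].
Proof.
exists (Num.sqrt (\sum_i norm2 ((row i A)^t*) ^+ 2)) => _ [x /= x1 <-].
apply: ler_wsqrtr; apply: ler_sum => i _.
rewrite ler_pXn2r// ?nnegrE ?norm2_ge0 ?normc_ge0// -lecR -norm_normcE.
have := norm2_CauchySchwarz ((row i A)^t*) x.
by rewrite trmxCK x1 mulr1 -row_mul mxE.
Qed.

Lemma norm2_mulmx_le n (A : 'M[C]_n) (x : 'cV[C]_n) :
  norm2 (A *m x) <= opnorm2 A * norm2 x.
Proof.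
have norm20 : norm2 (0 : 'cV[C]_n) = 0.
  by rewrite -(scale0r 0) norm2Z Normc.normc0 mul0r.
have [->|/norm2_gt0 x0] := eqVneq x 0; first by rewrite mulmx0 norm20 mulr0.
(* Rescaling by [a] puts [x] on the unit sphere, where [opnorm2] is defined. *)
pose a : C := (norm2 x)^-1%:C.
have a_norm : Normc.normc a = (norm2 x)^-1.
  by apply: (@complexI R); rewrite -norm_normcE ger0_norm// lecR invr_ge0 ltW.
rewrite -ler_pdivrMr// mulrC -a_norm -norm2Z scalemxAr.
apply: ub_le_sup; first exact: has_ubound_opnorm2.
by exists (a *: x) => //=; rewrite norm2Z a_norm mulVf// gt_eqF.
Qed.

(** Squared, the claim compares [x^* A^* A x] with [s x^* x], where [s] is the least eigenvalue of
    [A^* A]. In the coordinates [u = P x] of a unitary diagonalisation, it becomes a termwise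
    comparison of the sums of [d_i |u_i|^2] and [s |u_i|^2]. *)
Lemma sigma_min_le n (A : 'M[C]_n) (x : 'cV[C]_n) : (0 < n)%N ->
  sigma_min A * norm2 x <= norm2 (A *m x).
Proof.
move=> n_gt0; have [s [-> sE smin]] := sigma_minP A n_gt0.
have s_ge0 : 0 <= s by rewrite -lecR; exact: gram_eigenvalue_ge0 sE.
rewrite -(@ler_pXn2r _ 2)// ?nnegrE ?mulr_ge0 ?sqrtr_ge0 ?norm2_ge0//.
rewrite exprMn sqr_sqrtr// -lecR rmorphM /= !norm2_sqr.
set M := A^t* *m A in smin *.
have hermM : M^t* = M by rewrite /M trmx_mul map_mxM trmxCK.
have /orthomx_spectralP : M \is normalmx by apply/normalmxP; rewrite hermM.
set P := spectralmx M; set d := spectral_diag M => MP.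
have Pu : P \is unitarymx := spectral_unitarymx M.
have Punit : P \in unitmx := unitarymx_unit Pu.
(* Row [i] of [P] is a left eigenvector of [M] for [d 0 i]; it is nonzero because [P] is
   invertible. *)
have d_ge i : s%:C <= d 0 i.
  apply/smin/eigenvalueP; exists (row i P).
    rewrite MP -row_mul !mulmxA mulmxV// mul1mx.
    by apply/rowP => j; rewrite mul_diag_mx !mxE.
  apply: contraTneq Punit => Pi0; rewrite -row_free_unit.
  by apply/row_freePn; exists i; rewrite Pi0 sub0mx.
rewrite trmx_mul map_mxM mulmxA -[_ *m A^t* *m A]mulmxA -/M MP invmx_unitary//.
pose u := P *m x.
have -> : x^t* *m x = u^t* *m u.
  rewrite /u trmx_mul map_mxM mulmxA -[_ *m P^t* *m P]mulmxA.
  by rewrite -invmx_unitary// mulVmx// mulmx1.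
have -> : x^t* *m (P^t* *m diag_mx d *m P) *m x = u^t* *m (diag_mx d *m u).
  by rewrite /u trmx_mul map_mxM !mulmxA.
clearbody u; rewrite mxE mulr_sumr mxE; apply: ler_sum => i _.
rewrite mul_diag_mx !mxE [leRHS]mulrCA ler_wpM2r//.
by rewrite mulrC -normCK exprn_ge0.
Qed.

End EuclideanNorm.

Section QuadraticMatrixPolynomial.
Local Open Scope sesquilinear_scope.
Variables (R : realType) (n : nat).
Local Notation C := R[i].
Variables (A0 A1 A2 : 'M[C]_n) (r : R).
Hypotheses (n_gt0 : (0 < n)%N) (r_gt0 : 0 < r).
Hypothesis sigma_gt : r * opnorm2 A1 + r ^+ 2 * opnorm2 A2 < sigma_min A0.

Lemma norm2_A0_gt (x : 'cV[C]_n) : x != 0 ->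
  r * norm2 (A1 *m x) + r ^+ 2 * norm2 (A2 *m x) < norm2 (A0 *m x).
Proof.
move=> /norm2_gt0 x0; apply: lt_le_trans (sigma_min_le A0 x n_gt0).
apply: le_lt_trans (_ : _ <= (r * opnorm2 A1 + r ^+ 2 * opnorm2 A2) * norm2 x) _.
  rewrite mulrDl -[r * _ * _]mulrA -[r ^+ 2 * _ * _]mulrA.
  by rewrite lerD// ler_wpM2l ?norm2_mulmx_le// ?exprn_ge0// ltW.
by rewrite ltr_pM2r.
Qed.

(** Otherwise the strict upper bound in [norm2_A0_gt] would be zero, yet its left side is
    nonnegative. This makes [A0 *m x] an admissible [y]. *)
Lemma mulmx_A0_neq0 (x : 'cV[C]_n) : x != 0 -> A0 *m x != 0.
Proof.
move=> /norm2_A0_gt; apply: contraTneq => A0x.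
suff -> : norm2 (A0 *m x) = 0.
  by rewrite -leNgt addr_ge0 ?mulr_ge0 ?exprn_ge0 ?norm2_ge0 ?ltW.
by rewrite A0x -(scale0r 0) norm2Z Normc.normc0 mul0r.
Qed.

Lemma form_A0_neq0 (z1 z2 : C) (x : 'cV[C]_n) :
  `|z1| < r%:C -> `|z2| < r%:C -> x != 0 ->
  (A0 *m x)^t* *m (z1 ^+ 2 *: A2 + z2 *: A1 + A0) *m x != 0.
Proof.
move=> z1r z2r x0; have y_gt0 := norm2_gt0 (mulmx_A0_neq0 x0).
apply/eqP => /matrixP /(_ 0 0); set y := A0 *m x in y_gt0 *.
rewrite -mulmxA !mulmxDl -!scalemxAl -/y !mulmxDr -!scalemxAr.
rewrite mxE [X in X + _]mxE mxE [X in _ + X + _]mxE [RHS]mxE -norm2_sqr.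
(* If the form vanished, [|y|^2] would equal the modulus of the sum of the [A2] and [A1] terms. *)
move/eqP; rewrite addrC addr_eq0 => /eqP /(congr1 Num.norm).
rewrite normrN ger0_norm ?lecR ?sqr_ge0// => y_sqr.
(* Used with [k = 2] for the [A2] term and [k = 1] for the [A1] term. *)
have bound (z : C) (k : nat) (v : 'cV[C]_n) : `|z| < r%:C ->
    `|z ^+ k * (y^t* *m v) 0 0| <= (norm2 y * (r ^+ k * norm2 v))%:C.
  move=> zr; rewrite mulrCA rmorphM /= normrM.
  apply: ler_pM => //; last exact: norm2_CauchySchwarz.
  rewrite rmorphXn /= normrX; apply: lerXn2r; last exact: ltW.
    by rewrite nnegrE.
  by rewrite nnegrE lecR ltW.
have := lerD (bound z1 2 (A2 *m x) z1r) (bound z2 1 (A1 *m x) z2r).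
move=> /(le_trans (ler_normD _ _)); rewrite !expr1 -y_sqr -rmorphD /= lecR -mulrDr expr2.
(* Cancelling the positive factor [norm2 y] contradicts [norm2_A0_gt]. *)
by rewrite ler_pM2l// leNgt addrC norm2_A0_gt.
Qed.

End QuadraticMatrixPolynomial.

Theorem proposition7p3 (R : realType) (n : nat) (A0 A1 A2 : 'M[R[i]]_n) (r : R)
    (hn : (0 < n)%N) (hr : 0 < r)
    (hA : r * opnorm2 A1 + r ^+ 2 * opnorm2 A2 < sigma_min A0) :
  let D := [set z : R[i] | `|z| < r%:C] in
  let Q : 'M[{poly {poly R[i]}}]_n :=
    'X ^+ 2 *: map_mx (fun a => a%:P%:P) A2
    + 'Y *: map_mx (fun a => a%:P%:P) A1 + map_mx (fun a => a%:P%:P) A0 in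
  let P : 'M[{poly R[i]}]_n :=
    'X ^+ 2 *: map_mx polyC A2 + 'X *: map_mx polyC A1 + map_mx polyC A0 in
  stable2 Q (D `*` D) /\ (regular_mxpoly P /\ hyperstable P D).
Proof.
move=> D Q P.
have D0 : D 0 by rewrite /D /= normr0 ltcR.
have QE w : mxeval2 Q w = w.1 ^+ 2 *: A2 + w.2 *: A1 + A0.
  by apply/matrixP => i j; rewrite !mxE !hornerE.
have PE mu : mxeval P mu = mu ^+ 2 *: A2 + mu *: A1 + A0.
  by apply/matrixP => i j; rewrite !mxE !hornerE.
have detA0 : \det A0 != 0.
  (* [det0P] yields a row vector killed from the left, so it is applied to the transpose to get a
     column in the kernel of [A0]. *)
  apply/negP => /eqP det0; have := det0; rewrite -det_tr => /eqP/det0P[v v0 vA].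
  have : v^T != 0 by rewrite trmx_eq0.
  move=> /(mulmx_A0_neq0 hn hr hA)/negP; apply.
  by rewrite -trmx_eq0 trmx_mul trmxK vA.
have regP : regular_mxpoly P.
  (* Evaluating [\det P] at 0 gives [\det A0], since evaluation is a ring morphism and
     [P(0) = A0]. *)
  apply: contra detA0 => /eqP detP.
  have <- : mxeval P 0 = A0 by rewrite PE expr0n /= !scale0r !add0r.
  by rewrite (det_map_mx (horner_eval 0)) detP rmorph0.
split; [split|split=> //; split=> //].
- by exists (0, 0).
- move=> w [w1 w2] x x0; exists (A0 *m x); first exact: (mulmx_A0_neq0 hn hr hA).
  by rewrite QE; exact: (form_A0_neq0 hn hr hA).
- by exists 0.
- left; suff -> : D = ball (0 : R[i]^o) r%:C by exact: ball_open.
  by apply/seteqP; split=> z; rewrite /D /= -ball_normE /= sub0r normrN.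
- move=> x x0; exists (A0 *m x); first exact: (mulmx_A0_neq0 hn hr hA).
  by move=> mu Dmu; rewrite PE; exact: (form_A0_neq0 hn hr hA).
Qed.
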